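(* Let $M$ be a simple matroid on $[n]$ of rank $r\geq 2$. (i) The polynomials $\partial_1 f_M,\dots,\partial_n f_M$ are $\mathbb R$-linearly independent. (ii) If $M\neq U_{r,n}$, then $\partial_0\overline P_M,\partial_1\overline P_M,\dots,\partial_n\overline P_M$ are $\mathbb R$-linearly independent.
   Context: $f_M=\sum_{B\in\mathcal B(M)}\prod_{i\in B}x_i$ is the basis generating polynomial; $P_M=\sum_{I\in\mathcal I(M)}\big(\prod_{i\in I}x_i\big)x_0^{n-|I|}$ is the independent set generating polynomial; $\overline P_M=\partial_0^{\,n-r}P_M$, where $\partial_i=\partial/\partial x_i$. $U_{r,n}$ is the uniform matroid on $[n]$ whose bases are all $r$-subsets. A matroid is simple if it has no loops and no parallel pairs. *)

(* Defs.v *)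
From HB Require Import structures.
From mathcomp Require Import all_boot all_order all_algebra.
From mathcomp Require Export reals mpoly.

Set Implicit Arguments.
Unset Strict Implicit.
Unset Printing Implicit Defensive.

Import GRing.Theory.
Local Open Scope ring_scope.

(* The axioms are boolean, so two matroids are equal (in the Leibniz sense)
   exactly when they have the same independent sets. *)
Definition matroid_axioms (T : finType) (F : {set {set T}}) : bool :=
  [&& set0 \in F,
      [forall A in F, forall B : {set T}, (B \subset A) ==> (B \in F)] &
      [forall A in F, forall B in F,
         (#|A| < #|B|)%N ==> [exists x in B :\: A, x |: A \in F]]].

Record matroid (T : finType) := Matroid {
  indep : {set {set T}};
  indepP : matroid_axioms indep
}.

HB.instance Definition _ (T : finType) := [isSub for @indep T].
HB.instance Definition _ (T : finType) := [Equality of matroid T by <:].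

Section MatroidNotions.
Variables (T : finType) (M : matroid T).

Definition bases : {set {set T}} :=
  [set B | maxset [pred A : {set T} | A \in indep M] B].

Definition rank : nat := (\max_(A in indep M) #|A|)%N.

Definition loop (x : T) : bool := [set x] \notin indep M.

Definition parallel (x y : T) : bool :=
  [&& x != y, ~~ loop x, ~~ loop y & [set x; y] \notin indep M].

Definition simple_matroid : Prop :=
  (forall x, ~~ loop x) /\ (forall x y, ~~ parallel x y).

End MatroidNotions.

Definition uniform_indep (r n : nat) : {set {set 'I_n}} :=
  [set A : {set 'I_n} | (#|A| <= r)%N].

Lemma uniform_indepP (r n : nat) : matroid_axioms (uniform_indep r n).
Proof.
apply/and3P; split; first by rewrite inE cards0.
- apply/forall_inP => A; rewrite inE => leAr; apply/forallP => B.
  by apply/implyP => sBA; rewrite inE (leq_trans (subset_leq_card sBA)).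
- apply/forall_inP => A _; apply/forall_inP => B; rewrite inE => leBr.
  apply/implyP => ltAB.
  have /subsetPn[x Bx nAx] : ~~ (B \subset A).
    by apply: contraL ltAB => /subset_leq_card; rewrite leqNgt.
  apply/exists_inP; exists x; first by rewrite inE nAx.
  by rewrite inE cardsU1 nAx (leq_trans ltAB).
Qed.

(* U_{r,n}, meant for r <= n; see bases_uniform. *)
Definition uniform_matroid (r n : nat) : matroid 'I_n :=
  Matroid (uniform_indepP r n).

Lemma bases_uniform (r n : nat) : (r <= n)%N ->
  bases (uniform_matroid r n) = [set B : {set 'I_n} | #|B| == r].
Proof.
move=> lern; apply/setP => B; rewrite !inE; apply/maxsetP/eqP => /=.
- rewrite inE => -[leBr maxB]; apply/eqP; rewrite eqn_leq leBr leqNgt /=.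
  apply/negP => ltBr.
  have /subsetPn[x _ nBx] : ~~ ([set: 'I_n] \subset B).
    apply: contraL ltBr => /subset_leq_card.
    by rewrite cardsT card_ord -leqNgt; apply: leq_trans.
  have := maxB (x |: B); rewrite !inE cardsU1 nBx add1n => /(_ ltBr (subsetUr _ _)).
  by move/setP/(_ x); rewrite !inE eqxx (negbTE nBx).
- move=> cB; rewrite inE cB; split=> // A; rewrite inE => leAr sBA.
  by apply/esym/eqP; rewrite eqEcard sBA cB.
Qed.

Section GeneratingPolynomials.
Variables (R : realType) (n : nat) (M : matroid 'I_n).

Definition basis_poly : {mpoly R[n]} :=
  \sum_(B in bases M) \prod_(i in B) 'X_i.

(* x_0 is 'X_ord0; the variable of the ground set element i : 'I_n is
   'X_(lift ord0 i). *)
Definition indep_poly : {mpoly R[n.+1]} :=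
  \sum_(A in indep M)
     (\prod_(i in A) 'X_(lift ord0 i)) * 'X_ord0 ^+ (n - #|A|).

Definition reduced_indep_poly : {mpoly R[n.+1]} :=
  indep_poly^`M(ord0, n - rank M).

End GeneratingPolynomials.

Definition lin_indep (K : fieldType) (V : lmodType K) (I : finType)
    (v : I -> V) : Prop :=
  forall c : I -> K, \sum_i c i *: v i = 0 -> forall i, c i = 0.

(* Main.v *)
(* For an independent set S of size < r let N(S) be the set of i outside S with
   S + i independent.
   (i) Reading the coefficient of x^S for |S| = r - 1 in a relation
   sum_i c_i d_i f_M = 0 gives sum_{N(S)} c = 0.  This propagates down to all
   smaller independent S: the parallel classes of M / S partition N(S), and the
   relations for the sets S + i force every class to have the same c-sum as N(S)
   itself; as there are at least two classes, that sum is 0.  For a simple M,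
   S = {} and S = {i} give sum_j c_j = 0 = sum_{j <> i} c_j, so c_i = 0.
   (ii) Here the coefficients give c_0 (n - |S|) + sum_{N(S)} c = 0 for all
   independent S of size < r at once.  S = {} and S = {i} yield c_i = - c_0, so
   c_0 <> 0 would force |N(S)| = n - |S| for every S, making M uniform. *)
Require Import Defs.
From mathcomp Require Import all_boot all_order all_algebra.
From mathcomp Require Import zify.
Local Open Scope ring_scope.

Set Implicit Arguments.
Unset Strict Implicit.
Unset Printing Implicit Defensive.

Import GRing.Theory Num.Theory.

(** * Rank, bases, and parallelism in contractions *)

Section MatroidFacts.
Variables (T : finType) (M : matroid T).
Implicit Types (A B S : {set T}) (i j l : T).

Lemma indep0 : set0 \in indep M.
Proof. by have /and3P[] := indepP M. Qed.

Lemma indep_sub A B : A \in indep M -> B \subset A -> B \in indep M.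
Proof.
by move=> iA sBA; have /and3P[_ /forall_inP/(_ A iA)/forallP/(_ B)/implyP + _] :=
  indepP M; apply.
Qed.

Lemma indep_aug A B : A \in indep M -> B \in indep M -> (#|A| < #|B|)%N ->
  exists x, [/\ x \in B, x \notin A & x |: A \in indep M].
Proof.
move=> iA iB ltAB.
have /and3P[_ _ /forall_inP/(_ A iA)/forall_inP/(_ B iB)/implyP/(_ ltAB)] :=
  indepP M.
by case/exists_inP=> x /setDP[Bx nAx] ?; exists x.
Qed.

Lemma leq_card_rank A : A \in indep M -> (#|A| <= rank M)%N.
Proof. by move=> iA; rewrite /rank (bigD1 A) //= leq_maxl. Qed.

Lemma rank_leq_card : (rank M <= #|T|)%N.
Proof. by apply/bigmax_leqP => A _; apply: max_card. Qed.

Lemma exists_indep_rank : exists2 B, B \in indep M & #|B| = rank M.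
Proof.
have [|B iB eB] := @eq_bigmax_cond _ (mem (indep M)) (fun A => #|A|).
  by apply/card_gt0P; exists set0; apply: indep0.
by exists B.
Qed.

Lemma indep_extend A : A \in indep M -> (#|A| < rank M)%N ->
  exists2 x, x \notin A & x |: A \in indep M.
Proof.
move=> iA; have [B iB <-] := exists_indep_rank => /(indep_aug iA iB)[x [_ nAx ixA]].
by exists x.
Qed.

(** Augmentation forbids a maximal independent set smaller than the rank, so maximality can be
    tested by size. *)
Lemma basesE B : (B \in bases M) = (B \in indep M) && (#|B| == rank M).
Proof.
rewrite inE; apply/maxsetP/andP => /= [[iB maxB]|[iB /eqP cB]].
  split=> //; rewrite eqn_leq leq_card_rank //= leqNgt; apply/negP.
  case/(indep_extend iB) => x nBx ixB; have := maxB _ ixB (subsetUr _ _).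
  by move/setP/(_ x); rewrite !inE eqxx (negbTE nBx).
split=> // A iA sBA; apply/esym/eqP.
by rewrite eqEcard sBA cB leq_card_rank.
Qed.

Definition extenders S : {set T} := [set i | (i \notin S) && (i |: S \in indep M)].

(* Parallel elements of the contraction M / S. *)
Definition contraction_parallel S i j : bool :=
  (i == j) || (i |: (j |: S) \notin indep M).

(** Transitivity is augmentation: if [i] and [l] were both parallel to [j] but [S + i + l] were
    independent, then [S + j] could be enlarged by [i] or [l]. Reflexivity comes from the clause
    [i == j]. *)
Lemma contraction_parallel_equiv S :
  {in extenders S & &, equivalence_rel (contraction_parallel S)}.
Proof.
have sym i j : contraction_parallel S i j = contraction_parallel S j i.
  by rewrite /contraction_parallel eq_sym setUCA.
have trans i j l : i \in extenders S -> j \in extenders S -> l \in extenders S ->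
    contraction_parallel S j i -> contraction_parallel S j l ->
    contraction_parallel S i l.
  rewrite !inE /contraction_parallel => /andP[nSi iSi] /andP[nSj iSj] /andP[nSl iSl].
  have [-> // | neji] /= := eqVneq j i; have [<- | nejl] /= := eqVneq j l.
    by rewrite setUCA => ->; rewrite orbT.
  move=> Dji Djl; have [//|neil] := eqVneq i l; apply/negP => iil.
  have ltjil : (#|j |: S| < #|i |: (l |: S)|)%N.
    by rewrite !cardsU1 !inE negb_or neil nSi nSl nSj.
  have [x []] := indep_aug iSj iil ltjil.
  rewrite !inE negb_or => + /andP[nejx nSx] ixj.
  rewrite (negbTE nSx) orbF => /orP[] /eqP ex.
    by move: Dji; rewrite setUCA -ex ixj.
  by move: Djl; rewrite setUCA -ex ixj.
move=> i j l iX jX lX; split; first by rewrite /contraction_parallel eqxx.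
move=> pij; apply/idP/idP; first exact: trans.
by apply: trans => //; rewrite sym.
Qed.

(** Since [S] is at least two short of the rank, it can be extended twice in succession; the two
    added elements lie in different parallel classes. *)
Lemma exists_nonparallel_extenders S :
    S \in indep M -> (#|S|.+1 < rank M)%N ->
  exists i j, [/\ i \in extenders S, j \in extenders S &
                  ~~ contraction_parallel S i j].
Proof.
move=> iS ltS; have [j nSj ijS] := indep_extend iS (ltnW ltS).
have [|i] := indep_extend ijS; first by rewrite cardsU1 nSj add1n.
rewrite !inE negb_or => /andP[neij nSi] iijS; exists i, j.
rewrite !inE nSi nSj ijS negb_or neij negbK iijS; split=> //.
by apply: indep_sub iijS _; rewrite setUCA subsetUr.
Qed.

Lemma simple_indep1 i : simple_matroid M -> [set i] \in indep M.
Proof. by case=> /(_ i); rewrite negbK. Qed.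

Lemma simple_indep2 i j : simple_matroid M -> [set i; j] \in indep M.
Proof.
move=> Ms; have [<-|neij] := eqVneq i j; first by rewrite setUid simple_indep1.
case: (Ms) => _ /(_ i j).
by rewrite /parallel neij /loop !simple_indep1 //= negbK.
Qed.

Lemma extenders0 : simple_matroid M -> extenders set0 = setT.
Proof.
by move=> Ms; apply/setP => i; rewrite !inE setU0 simple_indep1.
Qed.

Lemma extenders1 j : simple_matroid M -> extenders [set j] = ~: [set j].
Proof.
by move=> Ms; apply/setP => i; rewrite !inE simple_indep2 // andbT.
Qed.

End MatroidFacts.

(** * Propagating vanishing sums down the independent sets *)

Section ExtenderSums.
Variables (R : numDomainType) (T : finType) (M : matroid T) (c : T -> R).

(* The parallel classes of M / S partition the extenders of S, and a vanishing
   sum over the extenders of i |: S says that the class of i has the same sum as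
   all extenders of S.  There are at least two classes, so this sum is 0. *)
Lemma extenders_sum_step (S : {set T}) :
    S \in indep M -> (#|S|.+1 < rank M)%N ->
    (forall i, i \in extenders M S -> \sum_(j in extenders M (i |: S)) c j = 0) ->
  \sum_(i in extenders M S) c i = 0.
Proof.
move=> iS ltS H; set D := extenders M S; set s := \sum_(i in D) c i.
have eqv := @contraction_parallel_equiv _ M S.
have partP := equivalence_partitionP eqv; set P := equivalence_partition _ _ in partP.
have sumP A : A \in P -> \sum_(i in A) c i = s.
  case/imsetP=> i iD ->; rewrite /s.
  rewrite [RHS](bigID (contraction_parallel M S i)) /=.
  rewrite [X in _ + X](_ : _ = 0) ?addr0; first by apply: eq_bigl => j; rewrite inE.
  (* The extenders of [S] not parallel to [i] are exactly the extenders of [i |: S]. *)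
  rewrite -[RHS](H i iD); apply: eq_bigl => j; rewrite !inE !negb_or !negbK.
  have [<-|neij] /= := eqVneq j i; first by rewrite andbF.
  rewrite -andbA; congr andb.
  rewrite [i |: _]setUCA; apply: andb_idl => ijS.
  by apply: indep_sub ijS _; rewrite setUCA subsetUr.
have: s *+ #|P| = s.
  rewrite -sumr_const [RHS](set_partition_big _ partP).
  by apply: eq_bigr => A /sumP ->.
have ltP : (1 < #|P|)%N.
  have [i [j [iD jD nij]]] := exists_nonparallel_extenders iS ltS.
  have covP x : x \in D -> x \in cover P by rewrite (cover_partition partP).
  apply/card_gt1P; exists (pblock P i), (pblock P j).
  rewrite !pblock_mem ?covP //; split=> //; apply: contraNneq nij => eij.
  by rewrite -(pblock_equivalence_partition eqv) // eij mem_pblock covP.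
rewrite -{2}[s]mulr1n => /eqP; rewrite -subr_eq0 -mulrnBr; last exact: ltnW.
by rewrite mulrn_eq0 subn_eq0 leqNgt ltP => /eqP.
Qed.

(** Downward induction on the size of [S]: [d] is its distance to size [rank M - 1], where the
    hypothesis applies, and adding an extender lowers [d] by one. *)
Lemma extenders_sum0 :
    (forall S : {set T}, S \in indep M -> #|S|.+1 = rank M ->
       \sum_(i in extenders M S) c i = 0) ->
  forall S : {set T}, S \in indep M -> (#|S| < rank M)%N ->
    \sum_(i in extenders M S) c i = 0.
Proof.
move=> H S; move dE: (rank M - #|S|.+1)%N => d.
elim: d S dE => [|d IHd] S dE iS ltS; first by apply: H => //; lia.
apply: extenders_sum_step => // [|i]; first lia.
by rewrite inE => /andP[nSi iiS]; apply: IHd => //; rewrite cardsU1 nSi /=; lia.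
Qed.

End ExtenderSums.

(** Induction on the size of [A]: for [x] in [A], the set [A :\ x] is independent and below the
    rank, so the count makes every element outside it an extender, [x] included. *)
Lemma matroid_eq_uniform (n : nat) (M : matroid 'I_n) :
    (forall S, S \in indep M -> (#|S| < rank M)%N ->
       #|extenders M S| = (n - #|S|)%N) ->
  M = uniform_matroid (rank M) n.
Proof.
move=> H; apply: val_inj; apply/setP => A /=; rewrite inE.
apply/idP/idP => [|leA]; first exact: leq_card_rank.
move cA: #|A| => k; elim: k A cA leA => [|k IHk] A cA leA.
  by rewrite (cards0_eq cA) indep0.
have [x Ax] : exists x, x \in A by apply/card_gt0P; rewrite cA.
have cAx : #|A :\ x| = k by move: (cardsD1 x A); rewrite Ax cA; lia.
have iAx : A :\ x \in indep M by apply: IHk => //; lia.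
have eX : extenders M (A :\ x) = ~: (A :\ x).
  apply/eqP; rewrite eqEcard; apply/andP; split.
    by apply/subsetP => y; rewrite inE => /andP[nAy _]; rewrite inE.
  by rewrite H //; [have := cardsC (A :\ x); rewrite card_ord; lia | lia].
have : x \in extenders M (A :\ x) by rewrite eX !inE eqxx.
by rewrite inE setD1K // => /andP[].
Qed.

(** * Coefficients of sums of distinct monomials and of iterated derivatives *)

Lemma mcoeff_sum_mpolyX (R : nzRingType) (n : nat) (I : finType) (F : {set I})
    (f : I -> 'X_{1..n}) (m : 'X_{1..n}) (i : I) :
    (forall j, (f j == m) = (j == i)) ->
  (\sum_(j in F) 'X_[R, f j])@_m = (i \in F)%:R.
Proof.
move=> fm; rewrite raddf_sum /=.
under eq_bigr => j _ do rewrite mcoeffX fm.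
have [iF|niF] := boolP (i \in F); last first.
  by rewrite big1 // => j jF; case: eqVneq jF niF => // -> ->.
by rewrite (bigD1 i) //= eqxx big1 ?addr0 // => j /andP[_ /negbTE ->].
Qed.

Lemma mcoeff_sum_mpolyX_eq0 (R : nzRingType) (n : nat) (I : finType)
    (F : {set I}) (f : I -> 'X_{1..n}) (m : 'X_{1..n}) :
  (forall j, f j != m) -> (\sum_(j in F) 'X_[R, f j])@_m = 0.
Proof.
move=> fm; rewrite raddf_sum /= big1 // => j _.
by rewrite mcoeffX (negbTE (fm j)).
Qed.

Lemma prod_mpolyXU (R : nzRingType) (n m : nat) (h : 'I_m -> 'I_n) (A : {set 'I_m}) :
  \prod_(i in A) 'X_(h i) = 'X_[R, \sum_(i in A) U_(h i)].
Proof. exact: mprodXE. Qed.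

Lemma mcoeff_mderivn (R : nzRingType) (n : nat) (p : {mpoly R[n]})
    (i : 'I_n) (k : nat) (m : 'X_{1..n}) :
  p^`M(i, k)@_m = p@_(m + U_(i) *+ k) *+ ((m i + k) ^_ k).
Proof.
rewrite mcoeff_mderivm addmC (bigD1 i) //= big1 => [|j neji].
  by rewrite mnmDE mulmnE mnm1E eqxx mul1n muln1.
by rewrite mulmnE mnm1E eq_sym (negbTE neji) ffactn0.
Qed.

(** * Linear relations among the derivatives of the basis polynomial *)

Section BasisPolynomial.
Variables (R : realType) (n : nat) (M : matroid 'I_n).
Implicit Types (S : {set 'I_n}) (i : 'I_n).

Lemma sum_mnm1 S : (\sum_(i in S) U_(i))%MM = mesym1 S.
Proof.
apply/mnmP=> i; rewrite mnmE mnm_sumE big_mkcond /= (bigD1 i) //= mnm1E eqxx.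
rewrite big1 ?addn0 => [|j neji]; first by case: ifP.
by rewrite mnm1E (negbTE neji); case: ifP.
Qed.

Lemma basis_polyE : basis_poly R M = \sum_(B in bases M) 'X_[mesym1 B].
Proof. by apply: eq_bigr => B _; rewrite prod_mpolyXU sum_mnm1. Qed.

(** The coefficient comes from the monomial [x^S * x_i]. For [i] in [S] this has a square, which no
    monomial of [f_M] has; otherwise it is the monomial of [i |: S]. *)
Lemma mcoeff_basis_poly_deriv S i :
  (basis_poly R M)^`M(i)@_(mesym1 S) = ((i \notin S) && (i |: S \in bases M))%:R.
Proof.
rewrite mcoeff_mderiv basis_polyE mnmE.
have [iS|niS] /= := boolP (i \in S).
  rewrite mcoeff_sum_mpolyX_eq0 ?mul0rn // => B; apply/eqP => /mnmP/(_ i).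
  by rewrite mnmDE mnm1E !mnmE eqxx iS; case: (i \in B).
rewrite mulr1n (_ : (_ + _)%MM = mesym1 (i |: S)).
  by apply: mcoeff_sum_mpolyX => B; rewrite (inj_eq (@inj_mesym1 _)).
apply/mnmP => j; rewrite mnmDE mnm1E !mnmE !inE eq_sym.
by case: eqVneq => [->|_]; rewrite ?(negbTE niS) ?addn0.
Qed.

Lemma basis_poly_relation (c : 'I_n -> R) S :
    \sum_i c i *: (basis_poly R M)^`M(i) = 0 ->
    S \in indep M -> #|S|.+1 = rank M ->
  \sum_(i in extenders M S) c i = 0.
Proof.
move=> /(congr1 (mcoeff (mesym1 S))); rewrite mcoeff0 raddf_sum /= => + iS cS.
move=> relS; rewrite -[RHS]relS big_mkcond /=; apply: eq_bigr => i _.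
rewrite mcoeffZ mcoeff_basis_poly_deriv inE basesE cardsU1.
by case: (i \in S); rewrite /= ?mulr0 // add1n cS eqxx andbT; case: ifP;
  rewrite ?mulr1 ?mulr0.
Qed.

End BasisPolynomial.

(** * Linear relations among the derivatives of the reduced independence polynomial *)

Section IndepPolynomial.
Variables (R : realType) (n : nat) (M : matroid 'I_n).
Implicit Types (S : {set 'I_n}) (i : 'I_n) (k : nat).

(** The exponent [k] of [x_0] is kept free of the size of [S], so that derivatives in [x_0] only
    shift it. *)
Definition indep_mnm S k : 'X_{1..n.+1} :=
  [multinom if unlift ord0 i is Some j then (j \in S : nat) else k | i < n.+1].

Lemma indep_mnm_ord0 S k : indep_mnm S k ord0 = k.
Proof. by rewrite mnmE unlift_none. Qed.

Lemma indep_mnm_lift S k i : indep_mnm S k (lift ord0 i) = (i \in S).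
Proof. by rewrite mnmE liftK. Qed.

Lemma mnm_ordSP (m1 m2 : 'X_{1..n.+1}) :
    m1 ord0 = m2 ord0 -> (forall i, m1 (lift ord0 i) = m2 (lift ord0 i)) ->
  m1 = m2.
Proof.
by move=> e0 eS; apply/mnmP => i; case: (unliftP ord0 i) => [j|] ->.
Qed.

Lemma indep_mnm_sum S k :
  (\sum_(i in S) U_(lift ord0 i) + U_(ord0) *+ k)%MM = indep_mnm S k.
Proof.
apply: mnm_ordSP => [|i]; rewrite mnmDE mulmnE mnm_sumE.
  by rewrite indep_mnm_ord0 mnm1E eqxx mul1n big1 // => j _; rewrite mnm1E.
rewrite -[RHS]addn0 mnm1E; congr (_ + _)%N.
have -> : indep_mnm S k (lift ord0 i) = mesym1 S i by rewrite indep_mnm_lift mnmE.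
rewrite -sum_mnm1 mnm_sumE.
by apply: eq_bigr => j _; rewrite !mnm1E (inj_eq lift_inj).
Qed.

Lemma indep_mnmU0 S k l : (indep_mnm S k + U_(ord0) *+ l)%MM = indep_mnm S (k + l).
Proof.
apply: mnm_ordSP => [|i]; rewrite mnmDE mulmnE mnm1E.
  by rewrite eqxx !indep_mnm_ord0 mul1n.
by rewrite !indep_mnm_lift addn0.
Qed.

Lemma indep_mnmU S k i : i \notin S ->
  (indep_mnm S k + U_(lift ord0 i))%MM = indep_mnm (i |: S) k.
Proof.
move=> niS; apply: mnm_ordSP => [|j]; rewrite mnmDE mnm1E.
  by rewrite !indep_mnm_ord0 addn0.
rewrite !indep_mnm_lift (inj_eq lift_inj) !inE eq_sym.
by case: eqVneq => [->|_]; rewrite ?(negbTE niS) ?addn0.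
Qed.

Lemma indep_polyE :
  indep_poly R M = \sum_(A in indep M) 'X_[indep_mnm A (n - #|A|)].
Proof.
apply: eq_bigr => A _; rewrite prod_mpolyXU mpolyXn -mpolyXD.
by rewrite indep_mnm_sum.
Qed.

Lemma mcoeff_indep_poly S k : k = (n - #|S|)%N ->
  (indep_poly R M)@_(indep_mnm S k) = (S \in indep M)%:R.
Proof.
move=> ->; rewrite indep_polyE; apply: mcoeff_sum_mpolyX => A.
apply/eqP/eqP => [/mnmP eAS|-> //]; apply/setP => i.
by have := eAS (lift ord0 i); rewrite !indep_mnm_lift; do 2!case: (_ \in _).
Qed.

(** [P_M] is squarefree in every variable except [x_0]. *)
Lemma mcoeff_indep_poly_eq0 (m : 'X_{1..n.+1}) i :
  (1 < m (lift ord0 i))%N -> (indep_poly R M)@_m = 0.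
Proof.
move=> lt1m; rewrite indep_polyE mcoeff_sum_mpolyX_eq0 // => A.
apply: contraTneq lt1m => <-; rewrite indep_mnm_lift.
by case: (_ \in _).
Qed.

(* The factorials produced by the n - r derivatives in x_0 are absorbed in the
   identity (n - k)! / (r - k)! = (n - k) / (r - k) * (n - k - 1)! / (r - k - 1)!,
   where k = #|S|. *)
Lemma reduced_indep_poly_relation (c : 'I_n.+1 -> R) S :
    \sum_i c i *: (reduced_indep_poly R M)^`M(i) = 0 ->
    S \in indep M -> (#|S| < rank M)%N ->
  c ord0 *+ (n - #|S|) + \sum_(i in extenders M S) c (lift ord0 i) = 0.
Proof.
move=> H iS ltS; have lern : (rank M <= n)%N.
  by rewrite -[n in (_ <= n)%N]card_ord rank_leq_card.
(* Homogeneity dictates [k]: the reduced polynomial has degree [rank M], one derivative takes 1 off,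
   and [S] accounts for [#|S|] of the rest. *)
set k := (rank M - #|S|.+1)%N; set d := (n - rank M)%N.
have := congr1 (mcoeff (indep_mnm S k)) H; rewrite mcoeff0 raddf_sum /=.
rewrite big_ord_recl mcoeffZ mcoeff_mderiv mcoeff_mderivn.
rewrite -[U_(ord0)%MM in X in X -> _]mulm1n !indep_mnmU0 !indep_mnm_ord0.
rewrite mcoeff_indep_poly; last by rewrite /k /d; lia.
rewrite iS -mulrnA (_ : ((k + 1 + d) ^_ d * k.+1)%N = ((n - #|S|) * (k + d) ^_ d)%N);
  last first.
  rewrite (_ : k.+1 = k + 1 + d - d)%N; last by lia.
  rewrite -ffactnSr (_ : k + 1 + d = (k + d).+1)%N ?ffactSS; last lia.
  by congr (_ * _)%N; rewrite /k /d; lia.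
rewrite (eq_bigr (fun i => (if i \in extenders M S then c (lift ord0 i) else 0) *+
    ((k + d) ^_ d))) => [|i _]; last first.
  rewrite mcoeffZ mcoeff_mderiv mcoeff_mderivn indep_mnm_lift inE.
  have [Si|nSi] /= := boolP (i \in S).
    rewrite (@mcoeff_indep_poly_eq0 _ i) ?mul0rn ?mulr0 //.
    by rewrite !mnmDE mulmnE !mnm1E indep_mnm_lift Si eqxx; lia.
  rewrite indep_mnmU // indep_mnmU0 indep_mnm_ord0 mulr1n.
  rewrite mcoeff_indep_poly ?cardsU1 ?nSi; last by rewrite /k /d; lia.
  by rewrite mulrnAr; case: ifP; rewrite ?mulr1 ?mulr0.
(* The common factor [(k + d) ^_ d] is positive because [d <= k + d], so it cancels. *)
rewrite sumrMnl -big_mkcond mulrnAr mulr1 mulrnA -mulrnDl => /eqP.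
by rewrite mulrn_eq0 eqn0Ngt ffact_gt0 leq_addl => /eqP.
Qed.

End IndepPolynomial.

Theorem theorem2p5 (R : realType) (n r : nat) (M : matroid 'I_n)
    (Msimple : simple_matroid M) (Mrank : rank M = r) (r_ge2 : (2 <= r)%N) :
  lin_indep (fun i : 'I_n => (basis_poly R M)^`M(i)) /\
  (M <> uniform_matroid r n ->
   lin_indep (fun i : 'I_n.+1 => (reduced_indep_poly R M)^`M(i))).
Proof.
have split1 (c : 'I_n -> R) i :
    \sum_(j in [set: 'I_n]) c j = c i + \sum_(j in ~: [set i]) c j.
  by rewrite (big_setD1 i) ?inE //= setTD.
split=> [c rel i | nU c rel].
  have sum0 := extenders_sum0 (fun S => @basis_poly_relation R n M c S rel).
  have := sum0 set0 (indep0 M); rewrite extenders0 // cards0 Mrank (split1 _ i).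
  have := sum0 [set i] (simple_indep1 _ Msimple).
  rewrite extenders1 // cards1 Mrank => /(_ r_ge2) ->.
  by rewrite addr0; apply; apply: ltnW.
have relS S := @reduced_indep_poly_relation R n M c S rel.
have cE i : c (lift ord0 i) = - c ord0.
  have n_gt0 : (0 < n)%N := leq_ltn_trans (leq0n i) (ltn_ord i).
  have := relS set0 (indep0 M); rewrite extenders0 // cards0 Mrank (split1 _ i).
  (* Writing [n] as [(n - 1) + 1] exposes the left side of the relation for [[set i]] inside the one
     for [set0]; removing it leaves [c_0 + c_i = 0]. *)
  rewrite subn0 -[n in c ord0 *+ n](subnK n_gt0) mulrnDr.
  rewrite [X in _ + X = 0]addrC addrACA.
  have := relS [set i] (simple_indep1 _ Msimple).
  rewrite extenders1 // cards1 Mrank => /(_ r_ge2) -> /(_ (ltnW r_ge2)).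
  by rewrite add0r mulr1n addrC => /eqP; rewrite addr_eq0 => /eqP.
have c0 : c ord0 = 0.
  apply/eqP; apply: contra_notT nU => c0; rewrite -Mrank.
  apply: matroid_eq_uniform => S iS ltS; have := relS S iS ltS.
  (* The relation becomes [c_0 * (n - #|S|) = c_0 * #|extenders M S|], and a nonzero [c_0]
     cancels. *)
  under eq_bigr do rewrite cE.
  rewrite sumr_const mulNrn => /subr0_eq; rewrite -mulr_natr -[RHS]mulr_natr.
  by move/(mulfI c0)/eqP; rewrite eqr_nat => /eqP.
by move=> i; case: (unliftP ord0 i) => [j|] -> //; rewrite cE c0 oppr0.
Qed.
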